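(* There exists a tree $T$ with maximum degree $\Delta(T)=3$ and game chromatic number $\chi_{\mathrm{g}}(T)=4$.
   Context: The $t$-coloring game on a finite graph $G$ with $t$ colors: Alice and Bob alternate turns, Alice first, each coloring an uncolored vertex with a color not used on any of its neighbors. Bob wins if at some point an uncolored vertex has no available color; otherwise Alice wins when all vertices are colored. $\chi_{\mathrm{g}}(G)$ is the least $t$ for which Alice has a winning strategy on the initially uncolored $G$. *)

(* Defs.v *)
From mathcomp Require Import all_boot.
Set Implicit Arguments. Unset Strict Implicit. Unset Printing Implicit Defensive.

Section Graphs.
Variable T : finType.
Variable e : rel T.

Definition simple_graph : Prop := symmetric e /\ irreflexive e.

Definition connected_graph : Prop := forall x y : T, connect e x y.

Definition acyclic_graph : Prop := forall c : seq T, ucycle e c -> size c < 3.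

Definition is_tree : Prop :=
  simple_graph /\ 0 < #|T| /\ connected_graph /\ acyclic_graph.

Definition degree (v : T) : nat := #|[set u | e v u]|.
Definition max_degree : nat := \max_(v : T) degree v.

(* A position: partial colouring, None = uncoloured. *)
Definition legal_move (t : nat) (f : T -> option 'I_t) (v : T) (c : 'I_t) : Prop :=
  f v = None /\ forall u, e v u -> f u <> Some c.

Definition update (t : nat) (f : T -> option 'I_t) (v : T) (c : 'I_t) : T -> option 'I_t :=
  fun x => if x == v then Some c else f x.

Definition stuck (t : nat) (f : T -> option 'I_t) (v : T) : Prop :=
  f v = None /\ forall c : 'I_t, exists u, e v u /\ f u = Some c.

Definition all_colored (t : nat) (f : T -> option 'I_t) : Prop :=
  forall v, f v <> None.

(* alice_wins t p f : Alice has a winning strategy from position f,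
   with Alice to move iff p = true.  Bob wins as soon as some uncoloured
   vertex has no available colour; Alice wins once all vertices are coloured.
   (The game is finite, so the inductive predicate is exactly the set of
   positions won by Alice.) *)
Inductive alice_wins (t : nat) : bool -> (T -> option 'I_t) -> Prop :=
| aw_done p f : all_colored f -> alice_wins p f
| aw_alice f : (forall v, ~ stuck f v) ->
    (exists v c, legal_move f v c /\ alice_wins false (update f v c)) ->
    alice_wins true f
| aw_bob f : (forall v, ~ stuck f v) ->
    (forall v c, legal_move f v c -> alice_wins true (update f v c)) ->
    alice_wins false f.

Definition alice_wins_game (t : nat) : Prop :=
  alice_wins (t := t) true (fun _ => None).

Definition game_chromatic_number_is (k : nat) : Prop :=
  alice_wins_game k /\ forall t, t < k -> ~ alice_wins_game t.

End Graphs.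

(* Main.v *)
Require Import Defs.
From mathcomp Require Import all_boot zify perm.
From Stdlib Require List.
Set Implicit Arguments. Unset Strict Implicit. Unset Printing Implicit Defensive.

(** With three colours, coloured vertices cut the tree into independent pieces, and a vertex is in
danger only while it has three neighbours. Bob wins by zugzwang: on a tree
with an even number of vertices Alice faces an even number of blank vertices at each of her turns.
Hence Bob can answer any move made outside an even piece by another move
outside of it, and Alice is finally forced to play inside; the typical piece where this is fatal is
a path of four blank vertices all seeing the same colour.

The tree consists of three copies of a 37-vertex [arm] attached to a centre. If Alice starts at
the centre, each arm is won by Bob moving first; otherwise Bob colours the centre, and Alice can
disturb only one of the two untouched arms. That Bob wins on an arm whose root sees a coloured
vertex is verified by checking an explicit strategy. Its backbone is the odd chain: two
coloured vertices joined by a blank path with an odd number (at least 3) of inner vertices let Bob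
win by successive double threats. By such threats Bob forces Alice to prepare two blank vertices of
a future zugzwang path, and then plays a vertex that both extends that path and threatens a
distant coloured vertex.

Four colours suffice since all degrees are at most 3. *)

(** * Pieces of a partially coloured tree *)

(* A component of blank vertices next to a coloured vertex, rooted there: at most two blank
   neighbours remain at each vertex. A node stores the colours of its coloured neighbours. *)
Inductive shape := Void | Node of seq nat & shape & shape.

Fixpoint ssize s := if s is Node _ l r then (ssize l + ssize r).+1 else 0.
Definition forbid c s := if s is Node F l r then Node (c :: F) l r else Void.
Definition nonvoid s := if s is Node _ _ _ then true else false.

(* A piece seen from one of its vertices: the colours it sees and its three branches. *)
Definition star : Type := seq nat * shape * shape * shape.

(** A zipper: [up] is the part of the piece beyond the parent, re-rooted at the parent, so every
    listed star describes the whole piece from another vertex. *)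
Fixpoint stars s up : seq star :=
  if s is Node F l r then
    (F, l, r, up) :: stars l (Node F r up) ++ stars r (Node F l up)
  else [::].

Lemma in_stars F l r up q : List.In q (stars (Node F l r) up) <->
  [\/ (F, l, r, up) = q, List.In q (stars l (Node F r up)) | List.In q (stars r (Node F l up))].
Proof.
split=> [[<-|/List.in_app_iff[H|H]]|[<-|H|H]]; [exact: Or31|exact: Or32|exact: Or33|by left|..];
  by right; apply: List.in_or_app; auto.
Qed.

Section Game.
Variables (V : finType) (e : rel V).
Hypothesis e_sym : symmetric e.
Implicit Types (f : V -> option 'I_3) (F : seq nat) (s l r : shape) (q : star).

(** [ps] holds slots for blank neighbours, [None] marking an absent one. The first half makes the
    colours outside [F] legal at a blank [v]; the second makes [v] stuck once [F] contains all
    colours. *)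
Definition surrounded f v F (ps : seq (option V)) :=
  (forall u, e v u -> Some u \in ps \/ exists2 c, f u = Some c & val c \in F) /\
  (forall c : 'I_3, val c \in F -> exists2 u, e v u & f u = Some c).

(* [occurs f p s x xs]: in the position [f], the piece [s] hangs at the vertex [p] (if any), with
   root [x] and vertices [xs]. *)
Inductive occurs f : option V -> shape -> option V -> seq V -> Prop :=
| OccVoid p : occurs f p Void None [::]
| OccNode p v F l r a b xs ys :
    f v = None -> (forall w, p = Some w -> e v w) ->
    surrounded f v F [:: p; a; b] ->
    occurs f (Some v) l a xs -> occurs f (Some v) r b ys ->
    occurs f p (Node F l r) (Some v) (v :: xs ++ ys).

Lemma occurs_uncolored f p s x xs :
  occurs f p s x xs -> forall v, v \in xs -> f v = None.
Proof.
elim=> {p s x xs} [//|p v F l r a b xs ys fv _ _ _ IHl _ IHr] u.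
by rewrite inE mem_cat => /orP[/eqP->|/orP[/IHl|/IHr]].
Qed.

Lemma occurs_size f p s x xs : occurs f p s x xs -> size xs = ssize s.
Proof.
by elim=> {p s x xs} //= p v F l r a b xs ys _ _ _ _ IHl _ IHr; rewrite size_cat IHl IHr.
Qed.

Lemma occurs_root f p s v xs : occurs f p s (Some v) xs -> v \in xs.
Proof. by move=> H; inversion H; subst; rewrite inE eqxx. Qed.

Lemma occurs_parent f p s v xs : occurs f (Some p) s (Some v) xs -> e p v.
Proof. by move=> H; inversion H; subst; rewrite e_sym; auto. Qed.

Lemma occurs_void f p x xs : occurs f p Void x xs -> x = None /\ xs = [::].
Proof. by move=> H; inversion H. Qed.

Lemma occurs_node f p F l r x zs : occurs f p (Node F l r) x zs ->
  exists v a b xs ys, [/\ x = Some v, zs = v :: xs ++ ys, f v = None,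
    (forall w, p = Some w -> e v w) & [/\ surrounded f v F [:: p; a; b],
    occurs f (Some v) l a xs & occurs f (Some v) r b ys]].
Proof. by move=> H; inversion H; subst; exists v, a, b, xs, ys. Qed.

Lemma surrounded_perm f v F ps ps' :
  perm_eq ps ps' -> surrounded f v F ps -> surrounded f v F ps'.
Proof. by move=> /perm_mem E [H1 H2]; split=> // u /H1; rewrite E. Qed.

(** The vertices are listed up to permutation, so that [zs] survives re-rooting. *)
Definition occurs_star f (v : V) q (zs : seq V) :=
  let: (F, l, r, up) := q in
  exists a b d xs ys ws, [/\ f v = None, surrounded f v F [:: a; b; d],
    [/\ occurs f (Some v) l a xs, occurs f (Some v) r b ys & occurs f (Some v) up d ws],
    uniq (v :: xs ++ ys ++ ws) & perm_eq zs (v :: xs ++ ys ++ ws)].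

Lemma occurs_star_swap12 f v F l r u zs :
  occurs_star f v (F, l, r, u) zs -> occurs_star f v (F, r, l, u) zs.
Proof.
case=> a [b [d [xs [ys [ws [fv S [Hl Hr Hu] U P]]]]]].
have Pp : perm_eq (v :: xs ++ ys ++ ws) (v :: ys ++ xs ++ ws).
  by rewrite perm_cons perm_catCA.
exists b, a, d, ys, xs, ws; split=> //.
- by apply: surrounded_perm S; apply/seq.permP => p /=; lia.
- by rewrite -(perm_uniq Pp).
- exact: perm_trans P Pp.
Qed.

Lemma occurs_star_swap23 f v F l r u zs :
  occurs_star f v (F, l, r, u) zs -> occurs_star f v (F, l, u, r) zs.
Proof.
case=> a [b [d [xs [ys [ws [fv S [Hl Hr Hu] U P]]]]]].
have Pp : perm_eq (v :: xs ++ ys ++ ws) (v :: xs ++ ws ++ ys).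
  by rewrite perm_cons perm_cat2l perm_catC.
exists a, d, b, xs, ws, ys; split=> //.
- by apply: surrounded_perm S; apply/seq.permP => p /=; lia.
- by rewrite -(perm_uniq Pp).
- exact: perm_trans P Pp.
Qed.

(** Re-rooting across an edge: the old centre with its two other branches becomes the upward branch
    of the child. *)
Lemma occurs_star_child f v F G y z r u zs :
  occurs_star f v (F, Node G y z, r, u) zs ->
  exists w, occurs_star f w (G, y, z, Node F r u) zs.
Proof.
case=> a [b [d [xs [ys [ws [fv S [Hl Hr Hu] U P]]]]]].
have [w [a' [b' [xs' [ys' [Ea Exs fw adj [S' Hy Hz]]]]]]] := occurs_node Hl.
subst a xs; exists w.
have Pp : perm_eq (v :: (w :: xs' ++ ys') ++ ys ++ ws) (w :: xs' ++ ys' ++ v :: ys ++ ws).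
  by apply/seq.permP => p; rewrite /= !count_cat /= ?count_cat /= ?count_cat; lia.
exists a', b', (Some v), xs', ys', (v :: ys ++ ws); split=> //.
- by apply: surrounded_perm S'; apply/seq.permP => p /=; lia.
- by split=> //; apply: OccNode fv _ S Hr Hu => w' [<-]; exact: occurs_parent Hl.
- by rewrite -(perm_uniq Pp).
- exact: perm_trans P Pp.
Qed.

Lemma stars_occur f s u v q zs : List.In q (stars s u) ->
  (exists F l r, s = Node F l r /\ occurs_star f v (F, l, r, u) zs) ->
  exists w, occurs_star f w q zs.
Proof.
elim: s u v => [//|F l IHl r IHr] u v /in_stars H [F' [l' [r' [[? ? ?] Hs]]]]; subst F' l' r'.
case: H => [<-|H|H]; first by exists v.
- case: l IHl Hs H => [//|G y z] IHl Hs H.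
  have [w Hw] := occurs_star_child Hs.
  by apply: (IHl _ w H); exists G, y, z.
- case: r IHr Hs H => [//|G y z] IHr Hs H.
  have [w Hw] := occurs_star_child (occurs_star_swap12 Hs).
  by apply: (IHr _ w H); exists G, y, z.
Qed.

(** Needed for Alice's moves: wherever she plays in the piece, a listed star is centred there. The
    upward branch grows at each re-rooting, so the induction bounds the two downward branches
    only. *)
Lemma occurs_stars f F l r u v a b d xs ys ws z :
  f v = None -> surrounded f v F [:: a; b; d] ->
  occurs f (Some v) l a xs -> occurs f (Some v) r b ys -> occurs f (Some v) u d ws ->
  uniq (v :: xs ++ ys ++ ws) -> z \in v :: xs ++ ys ->
  exists2 q, List.In q (stars (Node F l r) u) & occurs_star f z q (v :: xs ++ ys ++ ws).
Proof.
move: {2}(ssize l + ssize r) (leqnn (ssize l + ssize r)) => n.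
elim: n F l r u v a b d xs ys ws => [|n IH] F l r u v a b d xs ys ws Hn fv S Hl Hr Hu U.
all: have Hs : occurs_star f v (F, l, r, u) (v :: xs ++ ys ++ ws)
  by exists a, b, d, xs, ys, ws.
all: rewrite inE => /orP[/eqP->|]; first by exists (F, l, r, u) => //; left.
  move: Hn Hl Hr; case: l Hs => [|//] _; case: r => [|//] _.
  by move=> /occurs_void[_ ->] /occurs_void[_ ->].
rewrite mem_cat => /orP[zxs|zys].
- case: l Hn Hl Hs => [|G y t] Hn Hl Hs; first by case: (occurs_void Hl) zxs => _ ->.
  have [w [a' [b' [xs' [ys' [Ea Exs fw adj [S' Hy Hz]]]]]]] := occurs_node Hl; subst a xs.
  have Pp : perm_eq (v :: (w :: xs' ++ ys') ++ ys ++ ws) (w :: xs' ++ ys' ++ v :: ys ++ ws).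
    by apply/seq.permP => p; rewrite /= !count_cat /= ?count_cat /= ?count_cat; lia.
  have Hup : occurs f (Some w) (Node F r u) (Some v) (v :: ys ++ ws).
    by apply: OccNode fv _ S Hr Hu => w' [<-]; exact: occurs_parent Hl.
  have S2 : surrounded f w G [:: a'; b'; Some v].
    by apply: surrounded_perm S'; apply/seq.permP => p /=; lia.
  have [|||q Hq Hz'] := IH G y t (Node F r u) w a' b' (Some v) xs' ys' (v :: ys ++ ws) _ fw S2 Hy Hz Hup.
  + by move: Hn => /=; lia.
  + by rewrite -(perm_uniq Pp).
  + exact: zxs.
  exists q; first by apply/in_stars/Or32.
  move: q Hz' {Hq} => [[[F1 l1] r1] u1] [a1 [b1 [d1 [x1 [y1 [w1 [? ? ? ? Q]]]]]]].
  by exists a1, b1, d1, x1, y1, w1; split=> //; exact: perm_trans Pp Q.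
- case: r Hn Hr Hs => [|G y t] Hn Hr Hs; first by case: (occurs_void Hr) zys => _ ->.
  have [w [a' [b' [xs' [ys' [Ea Exs fw adj [S' Hy Hz]]]]]]] := occurs_node Hr; subst b ys.
  have Pp : perm_eq (v :: xs ++ (w :: xs' ++ ys') ++ ws) (w :: xs' ++ ys' ++ v :: xs ++ ws).
    by apply/seq.permP => p; rewrite /= !count_cat /= ?count_cat /= ?count_cat; lia.
  have Hup : occurs f (Some w) (Node F l u) (Some v) (v :: xs ++ ws).
    apply: OccNode fv _ _ Hl Hu; first by move=> w' [<-]; exact: occurs_parent Hr.
    by apply: surrounded_perm S; apply/seq.permP => p /=; lia.
  have S2 : surrounded f w G [:: a'; b'; Some v].
    by apply: surrounded_perm S'; apply/seq.permP => p /=; lia.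
  have [|||q Hq Hz'] := IH G y t (Node F l u) w a' b' (Some v) xs' ys' (v :: xs ++ ws) _ fw S2 Hy Hz Hup.
  + by move: Hn => /=; lia.
  + by rewrite -(perm_uniq Pp).
  + exact: zys.
  exists q; first by apply/in_stars/Or33.
  move: q Hz' {Hq} => [[[F1 l1] r1] u1] [a1 [b1 [d1 [x1 [y1 [w1 [? ? ? ? Q]]]]]]].
  by exists a1, b1, d1, x1, y1, w1; split=> //; exact: perm_trans Pp Q.
Qed.

(** The coloured neighbours recorded in the piece keep their colours because [z] was blank. *)
Lemma occurs_update f z c p s x xs :
  occurs f p s x xs -> f z = None -> z \notin xs -> p <> Some z ->
  occurs (update f z c) p s x xs.
Proof.
move=> H fz; elim: H => {p s x xs} [p _ _|p v F l r a b xs ys fv adj [S1 S2] Hl IHl Hr IHr].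
  exact: OccVoid.
rewrite inE mem_cat !negb_or => /and3P[zv zxs zys] pz.
have vz : Some v <> Some z by case=> E; rewrite E eqxx in zv.
apply: (OccNode _ adj _ (IHl zxs vz) (IHr zys vz)).
- by rewrite /update eq_sym (negbTE zv).
- split=> [u /S1[|[d fu dF]]|d /S2[u evu fu]]; first by left.
  + by right; exists d => //; rewrite /update; case: eqP => // E; rewrite E fz in fu.
  + by exists u => //; rewrite /update; case: eqP => // E; rewrite E fz in fu.
Qed.

(** The parent turns from a blank neighbour of the root into one more colour seen by it, which cuts
    the piece off. *)
Lemma occurs_coloured f w c s x xs :
  occurs f (Some w) s x xs -> f w = None -> w \notin xs ->
  occurs (update f w c) None (forbid (val c) s) x xs.
Proof.
case: s => [|F l r] H fw wxs; first by case: (occurs_void H) => -> ->; exact: OccVoid.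
have [v [a [b [ys [zs [Ex Exs fv adj [[S1 S2] Hl Hr]]]]]]] := occurs_node H; subst x xs.
move: wxs; rewrite inE mem_cat !negb_or => /and3P[wv wys wzs].
have vw : Some v <> Some w by case=> E; rewrite E eqxx in wv.
apply: (OccNode _ _ _ (occurs_update c Hl fw wys vw) (occurs_update c Hr fw wzs vw)) => //.
- by rewrite /update eq_sym (negbTE wv).
- split=> [u /S1[|[d fu dF]]|d].
  + rewrite inE => /orP[/eqP[->]|Hu]; last by left; rewrite inE Hu orbT.
    by right; exists c; rewrite ?inE ?eqxx // /update eqxx.
  + right; exists d; last by rewrite inE dF orbT.
    by rewrite /update; case: eqP => // E; rewrite E fw in fu.
  + rewrite inE => /orP[/eqP/val_inj->|/S2[u evu fu]].
      by exists w; [exact: adj|rewrite /update eqxx].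
    by exists u => //; rewrite /update; case: eqP => // E; rewrite E fw in fu.
Qed.

(** * Winning pieces and the parity of the blank vertices *)

Definition live f s := exists x xs, occurs f None s x xs /\ uniq xs.
Definition blanks f := #|[pred v | f v == None]|.

Lemma blanks_update f v c : f v = None -> blanks f = (blanks (update f v c)).+1.
Proof.
move=> fv; rewrite /blanks (cardD1 v) !inE fv eqxx add1n; congr _.+1.
by apply: eq_card => u; rewrite !inE /update; case: eqP.
Qed.

Lemma stuck_not_alice_wins p f v : stuck e f v -> ~ alice_wins e p f.
Proof. by move=> Hs Ha; case: Ha Hs => {p f} [p f /(_ v) H []|f H _ /H|f H _ /H]. Qed.

Lemma alice_wins_trueP f : alice_wins e true f ->
  all_colored f \/ exists v c, legal_move e f v c /\ alice_wins e false (update f v c).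
Proof. by move=> H; inversion H; [left|right]. Qed.

Lemma alice_wins_falseP f : alice_wins e false f -> all_colored f \/
  ((forall v, ~ stuck e f v) /\ forall v c, legal_move e f v c -> alice_wins e true (update f v c)).
Proof. by move=> H; inversion H; [left|right]. Qed.

(** The rest of the position is arbitrary up to parity: on a tree of even order the number of blanks
    is odd when Bob is to move and even when Alice is. [nonvoid] guarantees a blank vertex, so that
    the game is not over. *)
Definition bob_wins s :=
  nonvoid s /\ forall f, live f s -> odd (blanks f) -> ~ alice_wins e false f.
Definition alice_loses s :=
  nonvoid s /\ forall f, live f s -> ~~ odd (blanks f) -> ~ alice_wins e true f.
Definition bob_wins_star q :=
  forall f v zs, occurs_star f v q zs -> odd (blanks f) -> ~ alice_wins e false f.

Lemma occurs_starU f v q zs : occurs_star f v q zs -> f v = None.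
Proof. by case: q => [[[F l] r] u] [? [? [? [? [? [? [? ? ? ? ?]]]]]]]. Qed.

Lemma occurs_star_legal f v F l r u zs (c : 'I_3) :
  occurs_star f v (F, l, r, u) zs -> val c \notin F -> legal_move e f v c.
Proof.
case=> a [b [d [xs [ys [ws [fv [S1 _] [Hl Hr Hu] _ _]]]]]] cF; split=> // w /S1[Hw|[c' fw c'F]].
- have -> // : f w = None.
  by move: Hw; rewrite !inE => /or3P[]/eqP E; subst; [move: Hl|move: Hr|move: Hu];
    move=> H; exact: (occurs_uncolored H (occurs_root H)).
- by rewrite fw => -[E]; rewrite -E c'F in cF.
Qed.

(** Colouring the centre detaches its three branches from each other. *)
Lemma live_forbid f v F l r u zs (c : 'I_3) :
  occurs_star f v (F, l, r, u) zs ->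
  exists xs ys ws, [/\ exists x, occurs (update f v c) None (forbid (val c) l) x xs,
    exists y, occurs (update f v c) None (forbid (val c) r) y ys,
    exists w, occurs (update f v c) None (forbid (val c) u) w ws &
    uniq (xs ++ ys ++ ws)].
Proof.
case=> a [b [d [xs [ys [ws [fv _ [Hl Hr Hu] /=/andP[vn U] _]]]]]].
move: vn; rewrite !mem_cat !negb_or => /and3P[vx vy vw].
by exists xs, ys, ws; split=> //; [exists a|exists b|exists d]; exact: occurs_coloured.
Qed.

Lemma bob_wins_star_swap12 F l r u : bob_wins_star (F, l, r, u) -> bob_wins_star (F, r, l, u).
Proof. by move=> H f v zs /occurs_star_swap12; exact: H. Qed.

Lemma bob_wins_star_swap23 F l r u : bob_wins_star (F, l, r, u) -> bob_wins_star (F, l, u, r).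
Proof. by move=> H f v zs /occurs_star_swap23; exact: H. Qed.

Lemma bob_wins_star_child F G y z r u :
  bob_wins_star (G, y, z, Node F r u) -> bob_wins_star (F, Node G y z, r, u).
Proof. by move=> H f v zs /occurs_star_child[w]; exact: H. Qed.

Lemma live_star f F l r : live f (Node F l r) -> exists v zs, occurs_star f v (F, l, r, Void) zs.
Proof.
case=> x [zs [/occurs_node[v [a [b [xs [ys [_ -> fv _ [S Hl Hr]]]]]]] U]].
exists v, (v :: xs ++ ys), a, b, None, xs, ys, [::]; rewrite cats0; split=> //.
by split=> //; exact: OccVoid.
Qed.

(** Bob may regard any vertex of the piece as its centre. *)
Lemma bob_wins_of_star q s : List.In q (stars s Void) -> bob_wins_star q -> bob_wins s.
Proof.
case: s => [//|F l r] Hq Hb; split=> // f /live_star[v [zs Hs]].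
have [|w Hw] := stars_occur Hq (v := v) (zs := zs) (f := f); last exact: Hb Hw.
by exists F, l, r.
Qed.

Lemma bob_moves F l r u c : c < 3 -> c \notin F ->
  alice_loses (forbid c l) -> bob_wins_star (F, l, r, u).
Proof.
move=> c3 cF [_ Hl] f v zs Hs ob /alice_wins_falseP[/(_ v)|[_ Ha]].
  by rewrite (occurs_starU Hs).
pose d := Ordinal c3.
have [xs [ys [ws [[x Hx] _ _ U]]]] := live_forbid d Hs.
apply: Hl (Ha v d (occurs_star_legal Hs _)) => //.
- by exists x, xs; split=> //; move: U; rewrite cat_uniq => /andP[].
- by move: ob; rewrite (blanks_update d (occurs_starU Hs)).
Qed.

Lemma live_nonvoid f s : nonvoid s -> live f s -> ~ all_colored f.
Proof.
case: s => [//|F l r] _ /live_star[v [zs Hs]] /(_ v); by rewrite (occurs_starU Hs).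
Qed.

Lemma live_update f s x xs z c : occurs f None s x xs -> uniq xs -> f z = None ->
  z \notin xs -> live (update f z c) s.
Proof. by move=> H U fz zxs; exists x, xs; split=> //; exact: occurs_update. Qed.

(** Alice's next move lies in at most one of the two disjoint pieces; the other stays live with Bob
    to move. *)
Lemma two_threats f s1 s2 x1 x2 xs1 xs2 :
  occurs f None s1 x1 xs1 -> occurs f None s2 x2 xs2 -> uniq (xs1 ++ xs2) ->
  bob_wins s1 -> bob_wins s2 -> ~~ odd (blanks f) -> ~ alice_wins e true f.
Proof.
move=> H1 H2; rewrite cat_uniq => /and3P[U1 D U2] [n1 W1] [n2 W2] ob /alice_wins_trueP[].
  by apply: live_nonvoid n1 _; exists x1, xs1.
case=> z [c [[fz _] Ha]].
have ob' : odd (blanks (update f z c)) by move: ob; rewrite (blanks_update c fz) /= negbK.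
have [zxs|zxs] := boolP (z \in xs1).
- apply: W2 Ha => //; apply: live_update H2 U2 fz _.
  by apply: contra D => zxs2; apply/hasP; exists z.
- by apply: W1 Ha => //; exact: live_update H1 U1 fz zxs.
Qed.

Lemma bob_forks F l r u c : c < 3 -> c \notin F ->
  bob_wins (forbid c l) -> bob_wins (forbid c r) -> bob_wins_star (F, l, r, u).
Proof.
move=> c3 cF Wl Wr f v zs Hs ob /alice_wins_falseP[/(_ v)|[_ Ha]].
  by rewrite (occurs_starU Hs).
pose d := Ordinal c3.
have [xs [ys [ws [[x Hx] [y Hy] _ U]]]] := live_forbid d Hs.
apply: two_threats Hx Hy _ Wl Wr _ (Ha v d (occurs_star_legal Hs _)) => //.
- by move: U; rewrite catA cat_uniq => /andP[].
- by move: ob; rewrite (blanks_update d (occurs_starU Hs)).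
Qed.

(** * Stuck vertices and zugzwang *)

Definition colors := [:: 0; 1; 2].
Definition full F := all (fun c => c \in F) colors.

Lemma fullP F (c : 'I_3) : full F -> val c \in F.
Proof. by move=> /and4P[? ? ? _]; case: c => -[|[|[|]]]. Qed.

Fixpoint has_full s := if s is Node F l r then [|| full F, has_full l | has_full r] else false.

Lemma has_full_stuck f p s x xs : has_full s -> occurs f p s x xs -> exists v, stuck e f v.
Proof.
move=> H Ho; elim: Ho H => {p s x xs} [//|p v F l r a b xs ys fv _ [_ S2] _ IHl _ IHr] /=.
case/or3P=> [FF|/IHl//|/IHr//]; exists v; split=> // c.
by have [w evw fw] := S2 c (fullP c FF); exists w.
Qed.

Lemma has_full_bob_wins s : has_full s -> bob_wins s.
Proof.
move=> Hf; split=> [|f [x [xs [Ho _]]] _]; first by case: s Hf.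
by have [v] := has_full_stuck Hf Ho; exact: stuck_not_alice_wins.
Qed.

Lemma has_full_alice_loses s : has_full s -> alice_loses s.
Proof.
move=> Hf; split=> [|f [x [xs [Ho _]]] _]; first by case: s Hf.
by have [v] := has_full_stuck Hf Ho; exact: stuck_not_alice_wins.
Qed.

Lemma not_stuck_legal f v : f v = None -> ~ stuck e f v -> exists c, legal_move e f v c.
Proof.
move=> fv Hs; have [/existsP[c /forallP Hc]|/existsPn H] :=
  boolP [exists c : 'I_3, forall u, e v u ==> (f u != Some c)].
  by exists c; split=> // u evu; apply/eqP; have := Hc u; rewrite evu.
case: Hs; split=> // c; have := H c; rewrite negb_forall => /existsP[u].
by rewrite negb_imply negbK => /andP[evu /eqP fu]; exists u.
Qed.

(* A piece with an even number of vertices leaves Bob a blank vertex outside of it when it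
   is his turn, so he can hand the move back to Alice. *)
Lemma bob_passes f s : nonvoid s -> ~~ odd (ssize s) -> live f s -> odd (blanks f) ->
  (forall z c, f z = None -> live (update f z c) s -> ~ alice_wins e true (update f z c)) ->
  ~ alice_wins e false f.
Proof.
move=> ns es [x [xs [Ho U]]] ob H /alice_wins_falseP[|[nst Ha]].
  by apply: live_nonvoid ns _; exists x, xs.
(* If all blank vertices lay in the piece, their number would be its even size, against [ob]. *)
have [z /andP[zxs fz]] : exists z, (z \notin xs) && (f z == None).
  apply/existsP; apply: contraLR ob => /existsPn Hz.
  suff -> : blanks f = size xs by rewrite (occurs_size Ho).
  rewrite /blanks -(card_uniqP U); apply: eq_card => v; rewrite !inE.
  apply/eqP/idP => [fv|]; last exact: occurs_uncolored Ho v.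
  by have := Hz v; rewrite fv eqxx andbT negbK.
have [c Hc] := not_stuck_legal (eqP fz) (nst z).
by apply: H (Ha z c Hc); [exact/eqP|exact: live_update Ho U (eqP fz) zxs].
Qed.

Lemma even_bob_wins s : ~~ odd (ssize s) -> alice_loses s -> bob_wins s.
Proof.
move=> es [ns Al]; split=> // f Hl ob; apply: (bob_passes ns es Hl ob) => z c fz Hl'.
by apply: Al Hl' _; move: ob; rewrite (blanks_update c fz).
Qed.

Lemma in_nth (T : Type) (d x : T) ts i : i < size ts -> nth d ts i = x -> List.In x ts.
Proof.
elim: ts i => [//|y ts IH] [|i] /=; first by left.
by move=> Hi Hx; right; exact: IH Hx.
Qed.

Definition branches q c : seq shape :=
  let: (F, l, r, u) := q in [:: forbid c l; forbid c r; forbid c u].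

(** A move of Alice inside the piece colours the centre of a listed star and leaves a branch that
    Bob wins; the last hypothesis deals with her moves outside. *)
Lemma spoils_all f s :
  nonvoid s -> (forall q c, List.In q (stars s Void) -> c < 3 -> c \notin q.1.1.1 ->
     exists2 p, List.In p (branches q c) & bob_wins p) ->
  live f s -> ~~ odd (blanks f) ->
  (forall z c, f z = None -> live (update f z c) s -> ~ alice_wins e false (update f z c)) ->
  ~ alice_wins e true f.
Proof.
case: s => [//|F l r] ns H Hl eb Hout /alice_wins_trueP[]; first exact: live_nonvoid ns Hl.
case: (Hl) => x [zs [Ho U]].
have [v [a [b [xs [ys [Ex Exs fv adj [S Hol Hor]]]]]]] := occurs_node Ho.
case=> z [c [Hz Ha]]; have fz := Hz.1.
have [zin|zout] := boolP (z \in zs); last first.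
  by apply: (Hout _ _ fz _ Ha); exact: (live_update c Ho U fz zout).
have [|||q Hq Hqs] := @occurs_stars f F l r Void v a b None xs ys [::] z fv _ Hol Hor (OccVoid _ _) _ _.
- by apply: surrounded_perm S; apply/seq.permP => p /=; lia.
- by rewrite cats0 -Exs.
- by rewrite -Exs.
case: q Hq Hqs => [[[G y] t] u] Hq Hqs.
(* A colour in [G] is already on a neighbour of [z], so Alice could not have used it there. *)
have cG : val c \notin G.
  apply/negP => cG; case: Hqs => [? [? [? [? [? [? [_ [_ S2] _ _ _]]]]]]].
  by have [w ezw fw] := S2 c cG; case: Hz => _ /(_ w ezw).
have [p Hp [_ Wp]] := H _ _ Hq (ltn_ord c) cG.
have [vs [ws [us [[x1 H1] [x2 H2] [x3 H3] U3]]]] := live_forbid c Hqs.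
have ob : odd (blanks (update f z c)) by move: eb; rewrite (blanks_update c fz) /= negbK.
apply: Wp Ha => //.
move: U3; rewrite !cat_uniq => /and3P[U1 _ /and3P[U2 _ U3]].
by case: Hp => [<-|[<-|[<-|//]]]; [exists x1, vs|exists x2, ws|exists x3, us].
Qed.

(** When Alice plays outside, Bob either passes, the piece being even, or wins at once in the piece.
    Each exchange of passes uses two blank vertices, whence the induction on their number. *)
Lemma alice_spoiled s : nonvoid s -> ~~ odd (ssize s) \/ bob_wins s ->
  (forall q c, List.In q (stars s Void) -> c < 3 -> c \notin q.1.1.1 ->
     exists2 p, List.In p (branches q c) & bob_wins p) ->
  alice_loses s.
Proof.
move=> ns par H; split=> // f.
have [n] := ubnP (blanks f); elim: n f => // n IH f ltn Hl eb.
apply: (spoils_all ns H Hl eb) => z c fz Hl'.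
have ob : odd (blanks (update f z c)) by move: eb; rewrite (blanks_update c fz) /= negbK.
case: par => [es|[_ Ws]]; last exact: Ws.
apply: (bob_passes ns es Hl' ob) => y d fy Hl''; apply: IH => //.
- by move: ltn; rewrite (blanks_update c fz) (blanks_update d fy); lia.
- by move: ob; rewrite (blanks_update d fy).
Qed.

(** * Double threats and odd chains *)

(* A blank vertex seeing the colours [F] can be made stuck by colouring the root of its
   branch [h]. *)
Definition threat F h :=
  if h is Node G _ _ then has (fun d => (d \notin G) && full (d :: F)) colors else false.

(* Odd chains: [(chain x).1 c] holds when Bob, to move, wins on the piece [x] whose root has
   just received a neighbour of colour [c]; [(chain x).2 F h] when he wins around a vertex seeing
   [F] with branches [h] and [x]: he colours the root of [x], which threatens through [h]
   and continues the chain behind [x] at the same time. *)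
Fixpoint chain x : (nat -> bool) * (seq nat -> shape -> bool) :=
  if x is Node F p q then
    let: (p1, p2) := chain p in
    let: (q1, q2) := chain q in
    (fun c => [|| threat (c :: F) p, threat (c :: F) q, p2 (c :: F) q | q2 (c :: F) p],
     fun G h => has (fun c => [&& c \notin F, threat (c :: G) h & p1 c || q1 c]) colors)
  else (fun _ => false, fun _ _ => false).

Lemma has_color (P : pred nat) : has P colors -> exists2 c, c < 3 & P c.
Proof. by move=> /hasP[c]; rewrite /colors !inE => /or3P[]/eqP-> ?; [exists 0|exists 1|exists 2]. Qed.

(** Bob plays at the root of [h], so the star is first re-rooted there; the old centre becomes a
    branch whose root then sees all three colours. *)
Lemma threat_wins F h r u : threat F h -> bob_wins_star (F, h, r, u).
Proof.
case: h => [//|G y z] /has_color[d d3 /andP[dG dF]].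
apply/bob_wins_star_child/bob_wins_star_swap23/bob_wins_star_swap12.
by apply: (bob_moves d3 dG); apply: has_full_alice_loses => /=; rewrite dF.
Qed.

Lemma bob_wins_root F l r : bob_wins_star (F, l, r, Void) -> bob_wins (Node F l r).
Proof. by apply: bob_wins_of_star; left. Qed.

(** The two claims feed each other: colouring the root of [x] forks into a vertex threatened through
    [h] and a shorter chain in a branch of [x], while a root that has gained a colour threatens
    directly or continues through one of its branches. *)
Lemma chain_wins x :
  (forall c, (chain x).1 c -> bob_wins (forbid c x)) /\
  (forall F h u, (chain x).2 F h -> bob_wins_star (F, x, h, u)).
Proof.
elim: x => [//|F p [IHp1 IHp2] q [IHq1 IHq2]] /=.
case: (chain p) (chain q) IHp1 IHp2 IHq1 IHq2 => [p1 p2] [q1 q2] /= IHp1 IHp2 IHq1 IHq2.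
split=> [c|G h u].
- case/or4P=> H; apply: bob_wins_root.
  + exact: threat_wins.
  + by apply/bob_wins_star_swap12/threat_wins.
  + exact: IHp2.
  + by apply/bob_wins_star_swap12/IHq2.
- case/(has_color (P := fun c => [&& c \notin F, threat (c :: G) h & p1 c || q1 c])) => c c3 /and3P[cF Ht Hpq].
  apply: bob_wins_star_child.
  have Wh : bob_wins (forbid c (Node G h u)) by apply/bob_wins_root/threat_wins.
  case/orP: Hpq => [/IHp1|/IHq1] W.
  + by apply: bob_wins_star_swap23; apply: (bob_forks c3 cF).
  + by apply/bob_wins_star_swap12/bob_wins_star_swap23; apply: (bob_forks c3 cF).
Qed.

(** The alternatives run over the branch that threatens and, for a chain, the branch that continues
    it. Both need a colour already seen by the centre; a centre seeing none is dismissed before any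
    chain is evaluated. *)
Definition star_easy q :=
  let: (F, l, r, u) := q in
  ~~ nilp F && [|| threat F l, threat F r, threat F u,
    (chain r).2 F l, (chain u).2 F l, (chain l).2 F r, (chain u).2 F r, (chain l).2 F u | (chain r).2 F u].

Lemma star_easy_wins q : star_easy q -> bob_wins_star q.
Proof.
case: q => [[[F l] r] u] /andP[_].
have s12 := bob_wins_star_swap12; have s23 := bob_wins_star_swap23.
have [_ cl] := chain_wins l; have [_ cr] := chain_wins r; have [_ cu] := chain_wins u.
do ![case/orP]; move=> H.
- exact: threat_wins.
- by apply/s12/threat_wins.
- by apply/s23/s12/threat_wins.
- by apply/s12/cr.
- by apply/s23/s12/cu.
- exact: cl.
- by apply/s12/s23/s12/cu.
- by apply/s23/cl.
- by apply/s12/s23/cr.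
Qed.

(** Wins found by direct evaluation, which keeps the recorded strategy short. *)
Definition easy s := has_full s || has star_easy (stars s Void).

Lemma has_In (T : Type) (P : pred T) ts : has P ts -> exists2 x, List.In x ts & P x.
Proof.
elim: ts => [//|y ts IH] /= /orP[Hy|/IH[x Hx Px]]; first by exists y => //; left.
by exists x => //; right.
Qed.

Lemma easy_wins s : easy s -> bob_wins s.
Proof.
case/orP=> [/has_full_bob_wins//|/has_In[q Hq /star_easy_wins]].
exact: bob_wins_of_star.
Qed.

(** * Certificates for Bob's strategy *)

(* [Move i c j k]: Bob plays [c] at the [i]-th star, leaving Alice to move in the [j]-th resulting
   piece. [Fork i c j1 j2 k1 k2]: his move creates winning threats in two pieces. [Alice k ks]:
   [k] serves only for odd pieces, where Alice can pass; [ks] lists, for each move of hers that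
   leaves no odd chain, the piece in which Bob proceeds. *)
Inductive cert :=
| Easy
| Pass of cert
| Move of nat & nat & nat & cert
| Fork of nat & nat & nat & nat & cert & cert
| Alice of cert & cert
| Done
| Reply of nat & cert & cert.

Inductive goal := BobWins of shape | AliceLoses of shape | Replies of seq (seq shape).

Definition replies s : seq (seq shape) :=
  filter (fun ps => ~~ has easy ps)
    (flatten (map (fun q => map (branches q) (filter (fun c => c \notin q.1.1.1) colors))
                  (stars s Void))).

Definition void_star : star := ([::], Void, Void, Void).

Fixpoint check k g : bool :=
  match k, g with
  | Easy, BobWins s => easy s
  | Easy, AliceLoses s => has_full s
  | Pass k, BobWins s => ~~ odd (ssize s) && check k (AliceLoses s)
  | Move i c j k, BobWins s =>
      let q := nth void_star (stars s Void) i in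
      [&& i < size (stars s Void), c < 3, c \notin q.1.1.1 &
          check k (AliceLoses (nth Void (branches q c) j))]
  | Fork i c j1 j2 k1 k2, BobWins s =>
      let q := nth void_star (stars s Void) i in
      [&& i < size (stars s Void), c < 3, c \notin q.1.1.1, j1 < j2,
          check k1 (BobWins (nth Void (branches q c) j1)) &
          check k2 (BobWins (nth Void (branches q c) j2))]
  | Alice k ks, AliceLoses s =>
      [&& nonvoid s, ~~ odd (ssize s) || check k (BobWins s) & check ks (Replies (replies s))]
  | Done, Replies [::] => true
  | Reply j k ks, Replies (ps :: pss) =>
      check k (BobWins (nth Void ps j)) && check ks (Replies pss)
  | _, _ => false
  end.

Definition holds g := match g with
  | BobWins s => bob_wins s
  | AliceLoses s => alice_loses s
  | Replies pss => forall ps, List.In ps pss -> exists2 p, List.In p ps & bob_wins p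
  end.

(** The default [Void] is not [nonvoid], so an index out of range never certifies a win. *)
Lemma nth_In (ps : seq shape) j : nonvoid (nth Void ps j) -> List.In (nth Void ps j) ps.
Proof.
move=> H; have [Hj|Hj] := ltnP j (size ps); first exact: in_nth Hj erefl.
by rewrite nth_default in H.
Qed.


Lemma filter_In (T : Type) (P : pred T) x ts : List.In x ts -> P x -> List.In x (filter P ts).
Proof.
by elim: ts => [//|y ts IH] /= [->|Hx] Px; [rewrite Px; left|case: ifP => _; [right|]; exact: IH].
Qed.

Lemma flatten_In (T : Type) (x : T) ts tss : List.In x ts -> List.In ts tss -> List.In x (flatten tss).
Proof.
elim: tss => [//|y tss IH] Hx /= [->|Ht]; apply: List.in_or_app; first by left.
by right; exact: IH.
Qed.

Lemma in_replies s q c :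
  c < 3 -> List.In q (stars s Void) -> c \notin q.1.1.1 ->
  ~~ has easy (branches q c) -> List.In (branches q c) (replies s).
Proof.
move=> c3 Hq cq He; rewrite /replies; apply: filter_In; last exact: He.
apply: flatten_In; last exact: (List.in_map (fun q => map (branches q) (filter (fun c => c \notin q.1.1.1) colors)) _ _ Hq).
apply: List.in_map; apply: filter_In; last exact: cq.
by case: c {cq He} c3 => [|[|[|//]]] _; rewrite /=; tauto.
Qed.

Lemma check_sound k g : check k g -> holds g.
Proof.
elim: k g => [|k IH|i c j k IH|i c j1 j2 k1 IH1 k2 IH2|k IHk ks IHks||j k IHk ks IHks] [s|s|pss] //=.
- exact: easy_wins.
- exact: has_full_alice_loses.
- by case/andP=> es /IH; exact: even_bob_wins.
- case/and4P=> Hi c3 Hc /IH /=.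
  have := in_nth (d := void_star) Hi erefl; set q := nth void_star _ _ in Hc *.
  case: q Hc => [[[F l] r] u] Hc Hq Ha; apply: (bob_wins_of_star Hq).
  (* Beyond the three branches the entry is [Void], for which [alice_loses] fails. *)
  case: j Ha => [|[|[|j]]] /= Ha; last by case: Ha; rewrite nth_nil.
  + exact: bob_moves Ha.
  + by apply: bob_wins_star_swap12; exact: bob_moves Ha.
  + by apply/bob_wins_star_swap23/bob_wins_star_swap12; exact: bob_moves Ha.
- case/and3P=> Hi c3 /and4P[Hc Hj /IH1 /= H1 /IH2 /= H2].
  have := in_nth (d := void_star) Hi erefl; set q := nth void_star _ _ in Hc H1 H2 *.
  case: q Hc H1 H2 => [[[F l] r] u] Hc H1 H2 Hq; apply: (bob_wins_of_star Hq).
  (* Since [j1 < j2], the cases are the three pairs of distinct branches and those with an index out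
     of range. *)
  case: j1 j2 Hj H1 H2 => [|[|[|j1]]] [|[|[|j2]]] //= _ H1 H2.
  + exact: bob_forks H1 H2.
  + by apply: bob_wins_star_swap23; exact: bob_forks H1 H2.
  + by case: H2; rewrite nth_nil.
  + by apply/bob_wins_star_swap12/bob_wins_star_swap23; exact: bob_forks H1 H2.
  + by case: H2; rewrite nth_nil.
  + by case: H2; rewrite nth_nil.
  + by case: H2; rewrite nth_nil.
- case/and3P=> ns par /IHks /= Hr; apply: alice_spoiled => //.
    by case/orP: par => [|/IHk]; [left|right].
  move=> q c Hq c3 cq; have [He|He] := boolP (has easy (branches q c)).
    by have [p Hp /easy_wins] := has_In He; exists p.
  exact/Hr/in_replies.
- by case: pss.
- case: pss => [//|ps pss] /andP[/IHk /= Hk /IHks /= Hks] ps' [<-|]; last exact: Hks.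
  by exists (nth Void ps j) => //; apply: nth_In; case: Hk.
Qed.

(** * Symmetry under exchanging colours *)

Fixpoint recolor (g : nat -> nat) s :=
  if s is Node F l r then Node (map g F) (recolor g l) (recolor g r) else Void.

Section Recolor.
Variables (g : nat -> nat) (h : 'I_3 -> 'I_3).
Hypotheses (gK : involutive g) (hK : involutive h) (hg : forall c, val (h c) = g (val c)).

Lemma omap_involutive T (k : T -> T) : involutive k -> involutive (omap k).
Proof. by move=> kK [x|] //=; rewrite kK. Qed.

(** Exchanging the colours of the position undoes the exchange in the piece, since [g] and [h] are
    involutions. *)
Lemma occurs_recolor f p s x xs :
  occurs f p (recolor g s) x xs -> occurs (omap h \o f) p s x xs.
Proof.
elim: s p x xs => [|F l IHl r IHr] p x xs /= H.
  by case: (occurs_void H) => -> ->; exact: OccVoid.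
have [v [a [b [ys [zs [-> -> fv adj [[S1 S2] Hl Hr]]]]]]] := occurs_node H.
apply: (OccNode _ adj _ (IHl _ _ _ Hl) (IHr _ _ _ Hr)); first by rewrite /= fv.
split=> [u /S1[|[c fu]]|c cF]; first by left.
- case/mapP=> d dF cd; right; exists (h c); first by rewrite /= fu.
  by rewrite hg cd gK.
- have [|u evu fu] := S2 (h c); first by rewrite hg map_f.
  by exists u; rewrite //= fu /= hK.
Qed.

(** Updating before or after the exchange gives positions known to agree only pointwise, hence the
    [=1]. *)
Lemma alice_wins_recolor p f f' : f' =1 omap h \o f -> alice_wins e p f -> alice_wins e p f'.
Proof.
have [n] := ubnP (blanks f); elim: n p f f' => // n IH p f f' ltn E Ha.
have E' v : f v = omap h (f' v) by rewrite E /= (omap_involutive hK).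
have legalE v c : legal_move e f v (h c) <-> legal_move e f' v c.
  split=> -[fv H]; split=> [|u /H Hn Hc].
  - by rewrite E /= fv.
  - by apply: Hn; rewrite E' Hc.
  - by rewrite E' fv.
  - by apply: Hn; rewrite E /= Hc /= hK.
have nst : (forall v, ~ stuck e f v) -> forall v, ~ stuck e f' v.
  move=> H v [fv S]; apply: (H v); split=> [|c]; first by rewrite E' fv.
  by have [u [evu fu]] := S (h c); exists u; rewrite E' fu /= hK.
have upd v c : update f' v c =1 omap h \o update f v (h c).
  by move=> u; rewrite /= /update; case: eqP => //=; rewrite hK.
have lt v c : f v = None -> blanks (update f v c) < n.
  by move=> fv; move: ltn; rewrite (blanks_update c fv).
case: Ha IH ltn E E' legalE nst upd lt => {p f} [p f H|f nst0 [v [c [Hl Ha]]]|f nst0 H] IH ltn E E' legalE nst upd lt.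
- by apply: aw_done => v fv; apply: (H v); rewrite E' fv.
- apply: aw_alice; first exact: nst.
  exists v, (h c); split; first by apply/legalE; rewrite hK.
  by apply: (IH _ _ _ _ (upd v (h c))); rewrite hK //; apply: lt; case: Hl.
- apply: aw_bob; first exact: nst.
  move=> v c /legalE Hl; apply: (IH _ _ _ _ (upd v c)); last exact: H.
  by apply: lt; case: Hl.
Qed.

Lemma bob_wins_recolor s : bob_wins s -> bob_wins (recolor g s).
Proof.
case=> ns H; split=> [|f [x [xs [Ho U]]] ob Ha]; first by case: (s) ns.
apply: (H (omap h \o f)).
- by exists x, xs; split=> //; exact: occurs_recolor.
- suff -> : blanks (omap h \o f) = blanks f by [].
  by apply: eq_card => v; rewrite !inE /=; case: (f v).
- exact: alice_wins_recolor Ha.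
Qed.

End Recolor.

(** * Three equal arms around a centre *)

Lemma three_arms v s zs : occurs_star (fun _ => None) v ([::], s, s, s) zs -> ~~ odd #|V| ->
  (forall c, c < 3 -> bob_wins (forbid c s)) -> ~ alice_wins e true (fun _ : V => None : option 'I_3).
Proof.
move=> Hs eV W; set f := fun _ => None => /alice_wins_trueP[/(_ v)//|[z [c [_ Ha]]]].
have ob : odd (blanks (update f z c)).
  suff : ~~ odd (blanks f) by rewrite (@blanks_update f z c) //= negbK.
  by rewrite (_ : blanks f = #|V|) //; apply: eq_card => u; rewrite !inE.
have [Ez|/eqP zv] := eqVneq z v.
  subst z; have [xs [ys [ws [[x Hx] _ _ U]]]] := live_forbid c Hs.
  apply: (W c (ltn_ord c)).2 ob Ha; exists x, xs; split=> //.
  by move: U; rewrite cat_uniq => /andP[].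
have [a [b [d [xs [ys [ws [_ _ [Hx Hy Hw] /= /andP[vn U] _]]]]]]] := Hs.
(* A colour other than Alice's is legal at the centre even if she has just coloured one of its
   neighbours. *)
have [k k3 kc] : exists2 k, k < 3 & k != val c by case: (val c) => [|?]; [exists 1|exists 0].
have vz : update f z c v = None by rewrite /update; case: eqP => // E; case: zv.
have [|[_ Hb]] := alice_wins_falseP Ha; first by move/(_ v).
have {Hb}Ha := Hb v (Ordinal k3).
have /Ha : legal_move e (update f z c) v (Ordinal k3).
  split=> // u _; rewrite /update; case: eqP => // _ [Ec].
  by rewrite Ec eqxx in kc.
move: vn U; rewrite !mem_cat !negb_or => /and3P[vx vy vw] U.
have arm o rs : occurs f (Some v) s o rs -> v \notin rs -> z \notin rs ->
    occurs (update (update f z c) v (Ordinal k3)) None (forbid k s) o rs.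
  move=> H vr zr; apply: (occurs_coloured (Ordinal k3)) vz vr.
  by apply: occurs_update => // -[E]; case: zv.
have eb : ~~ odd (blanks (update (update f z c) v (Ordinal k3))).
  by move: ob; rewrite (blanks_update (Ordinal k3) vz).
move: U; rewrite !cat_uniq has_cat negb_or => /and3P[Ux /andP[Dxy Dxw] /and3P[Uy Dyw Uw]].
have Wk := W k k3.
have notin (rs ts : seq V) : ~~ has (mem rs) ts -> z \in rs -> z \notin ts.
  by move=> D zr; apply: contra D => zt; apply/hasP; exists z.
(* Two arms that avoid [z] are untouched, and together they form a double threat. *)
have [zx|zx] := boolP (z \in xs).
  apply: (two_threats (arm _ _ Hy vy (notin _ _ Dxy zx)) (arm _ _ Hw vw (notin _ _ Dxw zx))) => //.
  by rewrite cat_uniq Uy Dyw.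
have [zy|zy] := boolP (z \in ys).
  apply: (two_threats (arm _ _ Hx vx zx) (arm _ _ Hw vw (notin _ _ Dyw zy))) => //.
  by rewrite cat_uniq Ux Dxw.
apply: (two_threats (arm _ _ Hx vx zx) (arm _ _ Hy vy zy)) => //.
by rewrite cat_uniq Ux Dxy.
Qed.

End Game.

(** * Other numbers of colours, and trees given by parents *)

Section Greedy.
Variables (V : finType) (e : rel V) (t : nat).
Hypothesis deg_lt : forall v, degree e v < t.
Implicit Types f : V -> option 'I_t.

(** Pigeonhole: fewer than [t] neighbours cannot show all [t] colours. *)
Lemma free_color f v : exists c : 'I_t, forall u, e v u -> f u <> Some c.
Proof.
have [/existsP[c /forallP Hc]|/existsPn H] :=
  boolP [exists c : 'I_t, forall u, e v u ==> (f u != Some c)].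
  by exists c => u evu; apply/eqP; have := Hc u; rewrite evu.
have : [set Some c | c in 'I_t] \subset [set f u | u in [set u | e v u]].
  apply/subsetP => _ /imsetP[c _ ->]; have := H c; rewrite negb_forall => /existsP[u].
  rewrite negb_imply negbK => /andP[evu /eqP <-]; apply: imset_f; by rewrite inE.
have inj : injective (@Some 'I_t) by move=> x y [].
move=> /subset_leq_card; rewrite (card_imset _ inj) card_ord => Hle; have := leq_trans Hle (leq_imset_card _ _).
by rewrite leqNgt; have := deg_lt v; rewrite /degree => ->.
Qed.

(** No vertex ever gets stuck, so any legal play colours everything. *)
Lemma greedy_alice_wins p f : alice_wins e p f.
Proof.
have [n] := ubnP #|[pred v | f v == None]|; elim: n p f => // n IH p f ltn.
have [/existsP[v /eqP fv]|/existsPn H] := boolP [exists v, f v == None]; last first.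
  by apply: aw_done => v; apply/eqP.
have nst w : ~ stuck e f w.
  by case=> _ Hs; have [c Hc] := free_color f w; have [u [ewu fu]] := Hs c; exact: Hc ewu fu.
have step w c : f w = None -> #|[pred v | update f w c v == None]| < n.
  move=> fw; move: ltn; rewrite (cardD1 w) !inE fw eqxx add1n ltnS; apply: leq_trans.
  by rewrite ltnS; apply: subset_leq_card; apply/subsetP => u; rewrite !inE /update; case: (u == w).
case: p; [apply: aw_alice|apply: aw_bob] => //.
- by have [c Hc] := free_color f v; exists v, c; split=> //; apply: IH; exact: step.
- by move=> w c [fw _]; apply: IH; exact: step.
Qed.

End Greedy.

Section ParentTree.
Variables (n : nat) (par : nat -> nat).
Hypothesis par_lt : forall i, 0 < i < n -> par i < i.

Definition parent_rel : rel 'I_n := fun i j =>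
  ((0 < j) && (par j == i)) || ((0 < i) && (par i == j)).

Lemma parent_rel_sym : symmetric parent_rel.
Proof. by move=> i j; rewrite /parent_rel orbC. Qed.

Lemma parent_rel_irrefl : irreflexive parent_rel.
Proof.
move=> i; rewrite /parent_rel orbb; apply/negbTE/andP => -[i0 /eqP E].
by have := @par_lt i; rewrite i0 ltn_ord E ltnn => /(_ isT).
Qed.

Lemma parent_rel_lt (i j : 'I_n) : parent_rel i j -> j < i -> par i = j.
Proof.
move=> /orP[/andP[j0 /eqP E]|/andP[_ /eqP //]] ji.
by have := @par_lt j; rewrite j0 ltn_ord E => /(_ isT); rewrite ltnNge ltnW.
Qed.

Lemma parent_rel_connect (i j : 'I_n) : connect parent_rel i j.
Proof.
have n0 : 0 < n by exact: leq_ltn_trans (leq0n i) (ltn_ord i).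
suff root (k : 'I_n) : connect parent_rel (Ordinal n0) k.
  by apply: connect_trans (root j); rewrite (sym_connect_sym parent_rel_sym).
case: k => k; elim/ltn_ind: k => -[|k] IH Hk.
  by apply: eq_connect0; exact: val_inj.
have Hp : par k.+1 < k.+1 by exact: par_lt.
apply: connect_trans (IH _ Hp (ltn_trans Hp Hk)) _.
by apply: connect1; rewrite /parent_rel /= eqxx.
Qed.

(** The largest vertex [m] of a cycle has only smaller neighbours on it, all equal to its parent;
    its successor and predecessor then coincide, which is impossible among three or more distinct
    vertices. *)
Lemma parent_rel_acyclic : acyclic_graph parent_rel.
Proof.
move=> c /andP[Hc Hu]; rewrite ltnNge; apply/negP => Hs.
have [x0 xc] : exists x0, x0 \in c by case: (c) Hs => [//|x ?] _; exists x; rewrite inE eqxx.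
pose m := [arg max_(i > x0 in c) (i : nat)].
have [mc mmax] : m \in c /\ forall i, i \in c -> i <= m.
  by rewrite /m; case: arg_maxnP => // i ic Hi; split=> // j /Hi.
have le_par x : x \in c -> parent_rel m x -> par m = x.
  move=> xin mx; apply: (parent_rel_lt mx); rewrite ltn_neqAle mmax // andbT.
  by apply: contraTN mx => /eqP/val_inj->; rewrite parent_rel_irrefl.
have Hn : parent_rel m (next c m) by exact: next_cycle.
have Hp : parent_rel m (prev c m) by rewrite parent_rel_sym; exact: prev_cycle.
have Enp : next c m = prev c m.
  by apply: val_inj; rewrite /= -(le_par _ _ Hn) ?mem_next // -(le_par _ _ Hp) ?mem_prev.
have [i c' Hrot] := rot_to mc.
move: Enp; rewrite -(next_rot i) // -(prev_rot i) // Hrot.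
have Huq : uniq (m :: c') by rewrite -Hrot rot_uniq.
have : 2 < size (m :: c') by rewrite -Hrot size_rot.
case: c' {Hrot} Huq => [//|y [//|z d]] Huq _.
have mnot : m \notin [:: y, z & d] by case/andP: Huq.
(* In the cycle rotated to start at [m], the successor of [m] is [y] and its predecessor is the last
   entry of [z :: d], so [y] would be repeated. *)
rewrite next_nth prev_nth (memNindex mnot) /= !inE eqxx /= => Ey.
by case/and3P: Huq => _ /negP[]; rewrite Ey -[size d]/(size (z :: d)).-1 nth_last /= mem_last.
Qed.

Lemma parent_rel_tree : 0 < n -> is_tree parent_rel.
Proof.
move=> n0; split; first by split; [exact: parent_rel_sym|exact: parent_rel_irrefl].
by rewrite card_ord; split=> //; split; [exact: parent_rel_connect|exact: parent_rel_acyclic].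
Qed.

End ParentTree.

Section FewColors.
Variables (V : finType) (e : rel V).
Hypotheses (e_sym : symmetric e) (e_irr : irreflexive e) (V_gt0 : 0 < #|V|).
Hypothesis far : forall v, exists u w, [/\ e v u, e u w, w != v & ~~ e v w].

(** Bob answers the first move at [v] by giving a second colour to a vertex [w] at distance two, and
    the common neighbour [u] sees every colour. If there is only one colour, [u] is stuck right
    after Alice's move. *)
Lemma few_colors t : t < 3 -> ~ alice_wins_game e t.
Proof.
move=> t3 Hg; have /card_gt0P[v0 _] := V_gt0.
rewrite /alice_wins_game in Hg; move: Hg; set f := fun _ => None => Hg.
have [/(_ v0)//|[v [c [_ Ha]]]] : all_colored f \/
    exists v c, legal_move e f v c /\ alice_wins e false (update f v c).
  by inversion Hg; [left|right].
have [u [w [evu euw wv nvw]]] := far v.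
have uv : u == v = false by apply: contraTF evu => /eqP->; rewrite e_irr.
have uw : u == w = false by apply: contraTF euw => /eqP->; rewrite e_irr.
have [Hall|[nst Hb]] : all_colored (update f v c) \/ ((forall v', ~ stuck e (update f v c) v') /\
    forall v' c', legal_move e (update f v c) v' c' ->
      alice_wins e true (update (update f v c) v' c')) by inversion Ha; [left|right].
  by have := Hall u; rewrite /update uv.
have [/existsP[d /eqP dc]|/existsPn one] := boolP [exists d : 'I_t, d != c :> 'I_t]; last first.
  apply: (nst u); split=> [|d]; first by rewrite /update uv.
  by exists v; rewrite e_sym evu /update eqxx; split=> //; have /negPn/eqP-> := one d.
have legal : legal_move e (update f v c) w d.
  split=> [|x ewx]; rewrite /update; first by rewrite (negbTE wv).
  by case: eqP ewx => // ->; rewrite e_sym (negbTE nvw).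
have stu : stuck e (update (update f v c) w d) u.
  split=> [|k]; first by rewrite /update uv uw.
  have [->|kc] := eqVneq k c.
    by exists v; rewrite e_sym evu /update eqxx eq_sym (negbTE wv).
  exists w; rewrite euw /update eqxx; split=> //; congr Some; apply: val_inj.
  (* As [t] is at most 2, two colours different from [c] are equal. *)
  move: dc kc => /eqP; rewrite -!val_eqE /=.
  by have := ltn_ord k; have := ltn_ord d; have := ltn_ord c; lia.
case: stu => fu Hu; have := Hb w d legal; set g := update _ w d in fu Hu *.
move=> Hc; have : ~ all_colored g by move/(_ u).
have : ~ forall v', ~ stuck e g v' by move/(_ u); apply.
by inversion Hc.
Qed.
End FewColors.

(** * The tree *)

Definition leaf := Node [::] Void Void.
Definition path2 := Node [::] leaf Void.
Definition cherry := Node [::] leaf leaf.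
Definition tip := Node [::] leaf path2.
(** A spine of nine vertices, each carrying a small pendant tree, with a further [tip] at the end.
    The colour lists are empty because the arm is still blank. *)
Definition arm :=
  Node [::] path2 (Node [::] leaf (Node [::] tip
    (Node [::] cherry (Node [::] cherry (Node [::] cherry (Node [::] cherry
      (Node [::] tip (Node [::] leaf tip)))))))).

(* Found by computer search. *)
Definition strategy : cert :=
(Move 34 1 2 (Alice Easy (Reply 2 (Move 5 1 2 (Alice Easy (Reply 1 (Move 11 1 2 (Alice Easy
(Reply 2 (Fork 2 1 1 2 Easy (Move 6 0 2 (Alice Easy Done))) (Reply 2 (Fork 10 1 1 2 Easy (Move 8
0 2 (Alice Easy Done))) Done)))) (Reply 1 (Move 11 0 2 (Alice Easy (Reply 2 (Fork 2 0 1 2 Easy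
(Move 6 2 2 (Alice Easy Done))) (Reply 2 (Fork 10 0 1 2 Easy (Move 8 2 2 (Alice Easy Done)))
Done)))) (Reply 2 (Move 29 1 2 (Alice Easy (Reply 1 (Move 23 0 2 (Alice Easy (Reply 2 (Move 18 0
2 (Alice Easy (Reply 2 (Move 16 0 2 (Alice Easy Done)) (Reply 2 (Move 4 0 2 (Alice Easy Done))
Done)))) Done))) (Reply 1 (Move 23 0 2 (Alice Easy (Reply 2 (Move 18 0 2 (Alice Easy (Reply 2
(Move 16 2 2 (Alice Easy Done)) (Reply 2 (Move 4 0 2 (Alice Easy Done)) Done)))) Done))) (Reply
1 (Move 10 1 2 (Alice Easy (Reply 2 (Move 8 0 2 (Alice Easy (Reply 2 (Move 1 1 1 (Alice Easy
Done)) Done))) (Reply 2 (Fork 9 1 1 2 Easy (Move 9 0 2 (Alice Easy Done))) Done)))) (Reply 2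
(Pass (Alice Easy Done)) (Reply 1 (Move 10 1 2 (Alice Easy (Reply 2 (Move 8 0 2 (Alice Easy
(Reply 2 (Move 1 1 1 (Alice Easy Done)) Done))) (Reply 2 (Fork 9 1 1 2 Easy (Move 9 0 2 (Alice
Easy Done))) Done)))) (Reply 2 (Move 5 0 2 (Alice Easy Done)) (Reply 2 (Move 4 1 1 (Alice Easy
Done)) (Reply 2 (Move 5 2 2 (Alice Easy Done)) (Reply 2 (Move 5 0 2 (Alice Easy Done)) (Reply 2
(Move 5 1 2 (Alice Easy Done)) (Reply 2 (Move 5 2 2 (Alice Easy Done)) (Reply 2 (Move 3 1 2
(Alice Easy Done)) (Reply 2 (Move 3 2 2 (Alice Easy Done)) (Reply 2 (Move 20 1 1 (Alice Easy
Done)) Done)))))))))))))))) (Reply 1 (Move 10 1 2 (Alice Easy (Reply 2 (Move 8 0 2 (Alice Easy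
(Reply 2 (Move 1 1 1 (Alice Easy Done)) Done))) (Reply 2 (Fork 9 1 1 2 Easy (Move 9 0 2 (Alice
Easy Done))) Done)))) (Reply 2 (Move 2 1 2 (Alice Easy (Reply 2 (Pass (Alice Easy Done)) Done)))
(Reply 1 (Move 10 1 2 (Alice Easy (Reply 2 (Move 8 0 2 (Alice Easy (Reply 2 (Move 1 1 1 (Alice
Easy Done)) Done))) (Reply 2 (Fork 9 1 1 2 Easy (Move 9 0 2 (Alice Easy Done))) Done)))) (Reply
2 (Fork 4 1 1 2 (Move 2 1 2 (Alice Easy (Reply 2 (Pass (Alice Easy Done)) Done))) Easy) (Reply 1
(Fork 9 1 1 2 Easy (Move 2 1 2 (Alice Easy (Reply 2 (Move 4 1 2 (Alice Easy (Reply 2 (Pass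
(Alice Easy Done)) Done))) (Reply 2 (Move 4 1 2 (Alice Easy Done)) Done))))) (Reply 2 (Fork 4 1
1 2 (Move 2 1 2 (Alice Easy (Reply 2 (Pass (Alice Easy Done)) Done))) Easy) (Reply 2 (Move 5 0 2
(Alice Easy (Reply 2 (Move 3 1 2 (Alice Easy Done)) Done))) (Reply 2 (Move 5 1 2 (Alice Easy
(Reply 2 (Move 3 1 2 (Alice Easy Done)) Done))) (Reply 2 (Move 5 2 2 (Alice Easy (Reply 2 (Move
3 1 2 (Alice Easy Done)) Done))) (Reply 2 (Move 3 1 2 (Alice Easy (Reply 2 (Move 3 1 2 (Alice
Easy Done)) Done))) (Reply 2 (Move 3 2 2 (Alice Easy (Reply 2 (Move 3 1 2 (Alice Easy Done))
Done))) (Reply 2 (Move 5 0 2 (Alice Easy (Reply 2 (Move 26 0 2 (Alice (Move 20 1 2 (Alice Easy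
Done)) (Reply 0 (Move 5 0 2 (Alice Easy (Reply 2 (Move 3 1 2 (Alice Easy Done)) Done))) (Reply 2
(Move 5 1 2 (Alice Easy Done)) (Reply 2 (Move 0 1 1 (Alice Easy Done)) (Reply 2 (Move 0 1 1
(Alice Easy Done)) (Reply 2 (Move 17 0 1 (Alice Easy Done)) (Reply 2 (Fork 18 0 1 2 (Pass (Alice
Easy Done)) Easy) (Reply 2 (Move 3 1 2 (Alice Easy Done)) (Reply 2 (Fork 18 0 1 2 (Pass (Alice
Easy Done)) Easy) Done)))))))))) (Reply 2 (Move 20 1 2 (Alice Easy Done)) (Reply 2 (Move 20 1 2
(Alice Easy (Reply 2 (Move 3 0 2 (Alice Easy Done)) Done))) (Reply 2 (Move 20 1 2 (Alice Easy
(Reply 2 (Move 3 0 2 (Alice Easy Done)) Done))) (Reply 0 (Move 5 0 2 (Alice Easy (Reply 2 (Move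
3 1 2 (Alice Easy Done)) Done))) (Reply 2 (Move 5 1 2 (Alice Easy (Reply 2 (Move 3 0 2 (Alice
Easy Done)) Done))) (Reply 2 (Move 23 0 2 (Alice Easy Done)) (Reply 2 (Move 23 0 2 (Alice Easy
Done)) (Reply 2 (Move 3 1 2 (Alice (Move 20 0 2 (Alice Easy Done)) (Reply 0 (Move 5 1 2 (Alice
Easy (Reply 2 (Move 3 0 2 (Alice Easy Done)) Done))) (Reply 2 (Move 5 0 2 (Alice Easy Done))
(Reply 2 (Move 0 0 1 (Alice Easy Done)) (Reply 2 (Move 0 0 1 (Alice Easy Done)) (Reply 2 (Move
17 1 1 (Alice Easy Done)) (Reply 2 (Move 3 0 2 (Alice Easy Done)) (Reply 2 (Fork 18 1 1 2 (Pass
(Alice Easy Done)) Easy) (Reply 2 (Fork 18 1 1 2 (Pass (Alice Easy Done)) Easy) Done))))))))))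
(Reply 2 (Move 23 0 2 (Alice Easy (Reply 2 (Move 3 1 2 (Alice Easy Done)) Done))) (Reply 2 (Move
23 0 2 (Alice Easy Done)) (Reply 2 (Move 23 0 2 (Alice Easy (Reply 2 (Move 3 1 2 (Alice Easy
Done)) Done))) (Reply 2 (Move 20 1 2 (Alice Easy Done)) (Reply 2 (Move 20 1 2 (Alice Easy Done))
Done)))))))))))))))) Done))))))))))))))))) (Reply 2 (Move 31 0 2 (Alice Easy (Reply 2 (Move 2 1
2 (Alice Easy (Reply 2 (Move 5 0 2 (Alice Easy Done)) (Reply 2 (Move 3 0 2 (Alice Easy Done))
Done)))) Done))) (Reply 2 (Move 31 0 2 (Alice Easy Done)) (Reply 2 (Move 31 0 2 (Alice Easy
(Reply 2 (Move 2 1 2 (Alice Easy (Reply 2 (Move 5 0 2 (Alice Easy Done)) (Reply 2 (Move 3 0 2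
(Alice Easy Done)) Done)))) Done))) (Reply 1 (Move 15 0 2 (Alice Easy (Reply 2 (Fork 2 0 1 2
Easy (Move 6 1 2 (Alice Easy Done))) (Reply 2 (Fork 10 0 1 2 Easy (Move 8 1 2 (Alice Easy
Done))) Done)))) (Reply 2 (Move 31 1 2 (Alice Easy (Reply 2 (Move 26 0 2 (Alice Easy Done))
Done))) (Reply 2 (Move 14 0 2 (Alice Easy (Reply 2 (Fork 2 0 1 2 Easy (Move 11 1 2 (Alice Easy
Done))) (Reply 2 (Fork 16 0 1 2 Easy (Move 13 1 2 (Alice Easy Done))) Done)))) (Reply 2 (Move 31
1 2 (Alice Easy (Reply 2 (Move 26 2 2 (Alice Easy Done)) Done))) (Reply 2 (Move 19 1 2 (Alice
Easy (Reply 2 (Fork 2 1 1 2 Easy (Move 11 0 2 (Alice Easy Done))) (Reply 2 (Fork 16 1 1 2 Easy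
(Move 13 0 2 (Alice Easy Done))) Done)))) (Reply 2 (Move 5 0 2 (Alice Easy (Reply 2 (Move 26 1 2
(Alice Easy Done)) Done))) (Reply 2 (Move 5 0 2 (Alice Easy (Reply 2 (Move 26 2 2 (Alice Easy
Done)) Done))) (Reply 2 (Move 15 1 2 (Alice Easy (Reply 2 (Fork 2 1 1 2 Easy (Move 6 0 2 (Alice
Easy Done))) (Reply 2 (Fork 10 1 1 2 Easy (Move 8 0 2 (Alice Easy Done))) Done)))) (Reply 2
(Move 5 0 2 (Alice Easy (Reply 1 (Move 11 0 2 (Alice Easy (Reply 2 (Fork 2 0 1 2 Easy (Move 6 1
2 (Alice Easy Done))) (Reply 2 (Fork 10 0 1 2 Easy (Move 8 1 2 (Alice Easy Done))) Done))))
(Reply 1 (Move 11 1 2 (Alice Easy (Reply 2 (Fork 2 1 1 2 Easy (Move 6 2 2 (Alice Easy Done)))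
(Reply 2 (Fork 10 1 1 2 Easy (Move 8 2 2 (Alice Easy Done))) Done)))) (Reply 2 (Move 29 0 2
(Alice Easy (Reply 1 (Move 23 1 2 (Alice Easy (Reply 2 (Move 18 1 2 (Alice Easy (Reply 2 (Move
16 1 2 (Alice Easy Done)) (Reply 2 (Move 4 1 2 (Alice Easy Done)) Done)))) Done))) (Reply 1
(Move 23 1 2 (Alice Easy (Reply 2 (Move 18 1 2 (Alice Easy (Reply 2 (Move 16 2 2 (Alice Easy
Done)) (Reply 2 (Move 4 1 2 (Alice Easy Done)) Done)))) Done))) (Reply 2 (Pass (Alice Easy
Done)) (Reply 1 (Move 10 0 2 (Alice Easy (Reply 2 (Move 8 1 2 (Alice Easy (Reply 2 (Move 1 0 1
(Alice Easy Done)) Done))) (Reply 2 (Fork 9 0 1 2 Easy (Move 9 1 2 (Alice Easy Done))) Done))))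
(Reply 1 (Move 10 0 2 (Alice Easy (Reply 2 (Move 8 1 2 (Alice Easy (Reply 2 (Move 1 0 1 (Alice
Easy Done)) Done))) (Reply 2 (Fork 9 0 1 2 Easy (Move 9 1 2 (Alice Easy Done))) Done)))) (Reply
2 (Move 4 0 1 (Alice Easy Done)) (Reply 2 (Move 5 1 2 (Alice Easy Done)) (Reply 2 (Move 5 2 2
(Alice Easy Done)) (Reply 2 (Move 5 0 2 (Alice Easy Done)) (Reply 2 (Move 5 1 2 (Alice Easy
Done)) (Reply 2 (Move 5 2 2 (Alice Easy Done)) (Reply 2 (Move 3 0 2 (Alice Easy Done)) (Reply 2
(Move 3 2 2 (Alice Easy Done)) (Reply 2 (Move 20 0 1 (Alice Easy Done)) Done))))))))))))))))
(Reply 2 (Move 2 0 2 (Alice Easy (Reply 2 (Pass (Alice Easy Done)) Done))) (Reply 1 (Move 10 0 2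
(Alice Easy (Reply 2 (Move 8 1 2 (Alice Easy (Reply 2 (Move 1 0 1 (Alice Easy Done)) Done)))
(Reply 2 (Fork 9 0 1 2 Easy (Move 9 1 2 (Alice Easy Done))) Done)))) (Reply 1 (Move 10 0 2
(Alice Easy (Reply 2 (Move 8 1 2 (Alice Easy (Reply 2 (Move 1 0 1 (Alice Easy Done)) Done)))
(Reply 2 (Fork 9 0 1 2 Easy (Move 9 1 2 (Alice Easy Done))) Done)))) (Reply 1 (Fork 9 0 1 2 Easy
(Move 2 0 2 (Alice Easy (Reply 2 (Move 4 0 2 (Alice Easy (Reply 2 (Pass (Alice Easy Done))
Done))) (Reply 2 (Move 4 0 2 (Alice Easy Done)) Done))))) (Reply 2 (Fork 4 0 1 2 (Move 2 0 2
(Alice Easy (Reply 2 (Pass (Alice Easy Done)) Done))) Easy) (Reply 2 (Fork 4 0 1 2 (Move 2 0 2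
(Alice Easy (Reply 2 (Pass (Alice Easy Done)) Done))) Easy) (Reply 2 (Move 5 0 2 (Alice Easy
(Reply 2 (Move 3 0 2 (Alice Easy Done)) Done))) (Reply 2 (Move 5 1 2 (Alice Easy (Reply 2 (Move
3 0 2 (Alice Easy Done)) Done))) (Reply 2 (Move 5 2 2 (Alice Easy (Reply 2 (Move 3 0 2 (Alice
Easy Done)) Done))) (Reply 2 (Move 3 0 2 (Alice Easy (Reply 2 (Move 3 0 2 (Alice Easy Done))
Done))) (Reply 2 (Move 3 2 2 (Alice Easy (Reply 2 (Move 3 0 2 (Alice Easy Done)) Done))) (Reply
2 (Move 5 1 2 (Alice Easy (Reply 2 (Move 26 1 2 (Alice (Move 20 0 2 (Alice Easy Done)) (Reply 0
(Move 5 1 2 (Alice Easy (Reply 2 (Move 3 0 2 (Alice Easy Done)) Done))) (Reply 2 (Move 5 0 2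
(Alice Easy Done)) (Reply 2 (Move 0 0 1 (Alice Easy Done)) (Reply 2 (Move 0 0 1 (Alice Easy
Done)) (Reply 2 (Move 17 1 1 (Alice Easy Done)) (Reply 2 (Move 3 0 2 (Alice Easy Done)) (Reply 2
(Fork 18 1 1 2 (Pass (Alice Easy Done)) Easy) (Reply 2 (Fork 18 1 1 2 (Pass (Alice Easy Done))
Easy) Done)))))))))) (Reply 2 (Move 20 0 2 (Alice Easy (Reply 2 (Move 3 1 2 (Alice Easy Done))
Done))) (Reply 2 (Move 20 0 2 (Alice Easy Done)) (Reply 2 (Move 20 0 2 (Alice Easy (Reply 2
(Move 3 1 2 (Alice Easy Done)) Done))) (Reply 0 (Move 5 1 2 (Alice Easy (Reply 2 (Move 3 0 2
(Alice Easy Done)) Done))) (Reply 2 (Move 5 0 2 (Alice Easy (Reply 2 (Move 3 1 2 (Alice Easy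
Done)) Done))) (Reply 2 (Move 23 1 2 (Alice Easy Done)) (Reply 2 (Move 23 1 2 (Alice Easy Done))
(Reply 2 (Move 3 0 2 (Alice (Move 20 1 2 (Alice Easy Done)) (Reply 0 (Move 5 0 2 (Alice Easy
(Reply 2 (Move 3 1 2 (Alice Easy Done)) Done))) (Reply 2 (Move 5 1 2 (Alice Easy Done)) (Reply 2
(Move 0 1 1 (Alice Easy Done)) (Reply 2 (Move 0 1 1 (Alice Easy Done)) (Reply 2 (Move 17 0 1
(Alice Easy Done)) (Reply 2 (Fork 18 0 1 2 (Pass (Alice Easy Done)) Easy) (Reply 2 (Move 3 1 2
(Alice Easy Done)) (Reply 2 (Fork 18 0 1 2 (Pass (Alice Easy Done)) Easy) Done)))))))))) (Reply
2 (Move 23 1 2 (Alice Easy Done)) (Reply 2 (Move 23 1 2 (Alice Easy (Reply 2 (Move 3 0 2 (Alice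
Easy Done)) Done))) (Reply 2 (Move 23 1 2 (Alice Easy (Reply 2 (Move 3 0 2 (Alice Easy Done))
Done))) (Reply 2 (Move 20 0 2 (Alice Easy Done)) (Reply 2 (Move 20 0 2 (Alice Easy Done))
Done)))))))))))))))) Done))))))))))))))))) (Reply 2 (Move 31 1 2 (Alice Easy Done)) (Reply 2
(Move 31 1 2 (Alice Easy (Reply 2 (Move 2 0 2 (Alice Easy (Reply 2 (Move 5 1 2 (Alice Easy
Done)) (Reply 2 (Move 3 1 2 (Alice Easy Done)) Done)))) Done))) (Reply 2 (Move 31 1 2 (Alice
Easy (Reply 2 (Move 2 0 2 (Alice Easy (Reply 2 (Move 5 1 2 (Alice Easy Done)) (Reply 2 (Move 3 1
2 (Alice Easy Done)) Done)))) Done))) Done)))))))))))))))))).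

(** Preorder numbering: the root gets [k], the left branch starts at [k.+1], and the right branch
    follows it. *)
Fixpoint parents s k p : seq nat :=
  if s is Node _ l r then p :: parents l k.+1 k ++ parents r (k.+1 + ssize l) k else [::].

(** This is [1 + 3 * 37], even as the parity argument demands: the centre is 0 and the arms start at
    1, 38 and 75. *)
Definition order := 112.
Definition parent_list := 0 :: parents arm 1 0 ++ parents arm 38 0 ++ parents arm 75 0.
Definition par := nth 0 parent_list.
Definition tree : rel 'I_order := @parent_rel order par.

(** The relation [tree] on plain numbers, so that neighbourhoods can be computed without
    ordinals. *)
Definition adjacent i j := ((0 < j) && (par j == i)) || ((0 < i) && (par i == j)).
Definition nbrs i := filter (adjacent i) (iota 0 order).

Definition root_at s (k : nat) := if nonvoid s then [:: k] else [::].

Fixpoint fits s k p := if s is Node F l r then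
    [&& nilp F, perm_eq (nbrs k) (p :: root_at l k.+1 ++ root_at r (k.+1 + ssize l)),
        fits l k.+1 k & fits r (k.+1 + ssize l) k]
  else true.

(** The finite facts about the tree in one computation; the last conjunct provides the paths of
    length two that [few_colors] asks for. *)
Lemma tree_checked :
  [&& all (fun k => par k < k) (iota 1 111),
      all (fun k => size (nbrs k) <= 3) (iota 0 order), nbrs 0 == [:: 1; 38; 75],
      fits arm 1 0, fits arm 38 0, fits arm 75 0 &
      all (fun v => has (fun u => has (fun w => (w != v) && (w \notin nbrs v)) (nbrs u)) (nbrs v))
        (iota 0 order)].
Proof. by vm_compute. Qed.

Lemma strategy_checked : check strategy (BobWins (forbid 0 arm)).
(* The lazy conversion of the kernel is essential here: [&&] and [||] are strict in [vm_compute]. *)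
Proof. exact_no_check (erefl true). Qed.

Lemma treeE (i j : 'I_order) : tree i j = (val j \in nbrs (val i)).
Proof. by rewrite mem_filter mem_iota /= ltn_ord andbT. Qed.

Lemma nbrs_lt i j : j \in nbrs i -> j < order.
Proof. by rewrite mem_filter mem_iota => /and3P[]. Qed.

Lemma degreeE v : degree tree v = size (nbrs (val v)).
Proof.
rewrite /degree cardsE cardE /enum_mem -enumT size_filter size_filter -val_enum_ord count_map.
by apply: eq_count => u /=; rewrite unfold_in.
Qed.

(** The neighbourhoods compared by [fits] give the first half of [surrounded]; the second is empty
    on a blank tree. *)
Lemma fits_occurs s k p : fits s k p -> k + ssize s <= order -> p < order ->
  occurs tree (fun=> None) (Some (inord p)) s
    (if nonvoid s then Some (inord k : 'I_order) else None) (map inord (iota k (ssize s))).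
Proof.
elim: s k p => [|F l IHl r IHr] k p /=; first by move=> *; exact: OccVoid.
case/and4P=> /nilP-> Hn Hl Hr; rewrite addnS => Hk Hp.
have k_lt : k < order by lia.
rewrite iotaD map_cat.
have vk : val (inord k : 'I_order) = k by rewrite /= inordK.
have Hl' := IHl _ _ Hl; have Hr' := IHr _ _ Hr.
apply: OccNode (Hl' _ k_lt) (Hr' _ k_lt); [by []| | |lia|lia].
- move=> w [<-]; rewrite treeE vk (perm_mem Hn) /= inordK // inE eqxx //.
- split=> // u; rewrite treeE vk (perm_mem Hn) inE mem_cat => /or3P[/eqP<-|Hu|Hu]; left.
  + by rewrite inord_val inE eqxx.
  + by case: (l) Hu => [|? ? ?] //=; rewrite /root_at inE => /eqP<-; rewrite inord_val !inE eqxx orbT.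
  + by case: (r) Hu => [|? ? ?] //=; rewrite /root_at inE => /eqP<-; rewrite inord_val !inE eqxx !orbT.
Qed.

Lemma tree_sym : symmetric tree. Proof. exact: parent_rel_sym. Qed.

Definition exchange c i := if i == 0 then c else if i == c then 0 else i.

Lemma exchangeK c : involutive (exchange c).
Proof.
move=> i; rewrite /exchange; case: (eqVneq i 0) => [->|/negbTE i0].
  by case: (eqVneq c 0) => [->|] //; rewrite eqxx.
by case: (eqVneq i c) => [->|/negbTE ic]; rewrite ?eqxx ?i0 ?ic.
Qed.

Lemma exchange_tperm (c i : 'I_3) : val (tperm ord0 c i) = exchange (val c) (val i).
Proof.
rewrite /exchange; case: tpermP => [->|->|/eqP i0 /eqP ic] //=.
  by rewrite eqxx; case: eqP => [->|].
by rewrite -!val_eqE /= in i0 ic; rewrite (negbTE i0) (negbTE ic).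
Qed.

(** The strategy is checked only for a root seeing colour 0; exchanging 0 and [c] carries it
    over. *)
Lemma arm_wins c : c < 3 -> bob_wins tree (forbid c arm).
Proof.
move=> c3; have W0 : bob_wins tree (forbid 0 arm) := check_sound tree_sym strategy_checked.
exact: (bob_wins_recolor (@exchangeK c) (@tpermK _ _ _) (exchange_tperm (Ordinal c3)) W0).
Qed.

Lemma inord0 : inord 0 = ord0 :> 'I_order. Proof. by apply: val_inj; exact: inordK. Qed.

Lemma arm_occurs k : fits arm k 0 -> k + ssize arm <= order ->
  occurs tree (fun=> None) (Some ord0) arm (Some (inord k)) (map inord (iota k (ssize arm))).
Proof. by move=> Hk Hk'; have := fits_occurs Hk Hk' (isT : 0 < order); rewrite inord0. Qed.

Lemma tree_star :
  occurs_star tree (fun=> None) ord0 ([::], arm, arm, arm) (map inord (iota 0 order)).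
Proof.
have /and5P[_ _ /eqP N0 F1 /and3P[F2 F3 _]] := tree_checked.
exists (Some (inord 1)), (Some (inord 38)), (Some (inord 75)).
exists (map inord (iota 1 37)), (map inord (iota 38 37)), (map inord (iota 75 37)).
have E : ord0 :: map inord (iota 1 37) ++ map inord (iota 38 37) ++ map inord (iota 75 37) =
    map inord (iota 0 order) :> seq 'I_order.
  by rewrite -!map_cat -inord0 -map_cons -iotaD -iotaD.
split.
- by [].
- split=> [u|c]; last by rewrite in_nil.
  rewrite treeE => Hu; left.
  apply/(mapP (s := [:: 1; 38; 75]) (f := fun k => Some (inord k))).
  by exists (val u); [rewrite -N0; exact: Hu|rewrite inord_val].
- by split; [exact: arm_occurs F1 _|exact: arm_occurs F2 _|exact: arm_occurs F3 _].
- rewrite E; have inj : {in iota 0 order &, injective (fun k => inord k : 'I_order)}.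
    move=> i j; rewrite !mem_iota => /andP[_ Hi] /andP[_ Hj] H.
    by rewrite -(inordK Hi) H (inordK Hj).
  by rewrite (map_inj_in_uniq inj); exact: iota_uniq.
- rewrite E; exact: perm_refl.
Qed.

Theorem theorem8p7 :
  exists (T : finType) (e : rel T),
    is_tree e /\ max_degree e = 3 /\ game_chromatic_number_is e 4.
Proof.
have /and5P[/allP Hpar /allP Hdeg /eqP N0 F1 /and3P[F2 F3 /allP Hfar]] := tree_checked.
have par_lt i : 0 < i < order -> par i < i by move=> Hi; apply: Hpar; rewrite mem_iota.
have t_irr : irreflexive tree := parent_rel_irrefl par_lt.
have deg_le v : degree tree v <= 3.
  by rewrite degreeE; apply: Hdeg; rewrite mem_iota /= ltn_ord.
have order_gt0 : 0 < #|'I_order| by rewrite card_ord.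
exists 'I_order, tree; split; first exact: parent_rel_tree.
split.
  apply/eqP; rewrite eqn_leq; apply/andP; split; first by apply/bigmax_leqP => v _.
  (* The centre attains degree three. *)
  by apply: leq_trans (leq_bigmax ord0); rewrite degreeE N0.
split=> [|t]; first exact: greedy_alice_wins.
(* Three colours call for the strategy on the arms; fewer are settled first by [few_colors]. *)
rewrite ltnS leq_eqVlt => /orP[/eqP->|]; last first.
  apply: (few_colors tree_sym t_irr order_gt0) => v.
  have /Hfar : val v \in iota 0 order by rewrite mem_iota ltn_ord.
  case/hasP=> u uv /hasP[w wu /andP[wv nvw]].
  have [Vu Vw] : val (inord u : 'I_order) = u /\ val (inord w : 'I_order) = w.
    by split; apply: inordK; [exact: nbrs_lt uv|exact: nbrs_lt wu].
  exists (inord u), (inord w); split.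
  - by rewrite treeE Vu; exact: uv.
  - by rewrite treeE Vu Vw; exact: wu.
  - by rewrite -val_eqE Vw; exact: wv.
  - by rewrite treeE Vw; exact: nvw.
have even_order : ~~ odd #|'I_order| by rewrite card_ord.
exact: (three_arms tree_star even_order arm_wins).
Qed.
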